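(* Let $k$ be a field, $A$ a nonzero associative $k$-algebra with identity, and let $R$ be an entire atomistic subsemiring of $S(A)$, with set of atoms $\mathcal{Q}(R)$. Let $\zeta^*$ be the transitive closure of the relation $\zeta$ on $\mathcal{Q}(R)$, and write $\bar X$ for the $\zeta^*$-equivalence class of $X\in\mathcal{Q}(R)$. Then: (1) The induced multiplication on classes, $\bar X\circ\bar Y=\bar Z$ for any $Z\in X\circ Y$, makes $Q(R):=\mathcal{Q}(R)/\zeta^*$ into a monoid (in particular, this multiplication is well defined). (2) If $R$ is weakly reproducible, then $Q(R)$ is a group.
   Context: $S(A)$ is the lattice of $k$-subspaces of $A$, with sum, intersection, and product $EF=\mathrm{span}\{ef\mid e\in E,f\in F\}$; the subspace $k1_A$ is also written $k$. An atomistic subsemiring of $S(A)$ is a subset $R\subset S(A)$ containing $\{0\}$ and $k1_A$, closed under arbitrary sums, arbitrary intersections (of nonempty families) and finite products (the maximum of $R$ need not be $A$), such that every nonzero element of $R$ is a (possibly infinite) sum of atoms of $R$, an atom being a minimal nonzero element of $R$. $\mathcal{Q}(R)$ is the set of atoms; it contains $k=k1_A$. $R$ is entire if $EF=0$ with $E,F\in R$ implies $E=0$ or $F=0$. For $X,Y\in\mathcal{Q}(R)$, $X\circ Y=\{Z\in\mathcal{Q}(R)\mid Z\subset XY\}$. The relation $\zeta$ on $\mathcal{Q}(R)$: $X\,\zeta\,Y$ iff there exist $n\ge1$ and $Z_1,\dots,Z_n\in\mathcal{Q}(R)$ with $X,Y\subset Z_1Z_2\cdots Z_n$. An entire atomistic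 subsemiring $R$ is weakly reproducible if for every $X\in\mathcal{Q}(R)$ there exist $Y,Z\in\mathcal{Q}(R)$ with $k\in (X\circ Y)\cap (Z\circ X)$. *)

(* Defs.v *)
From HB Require Import structures.
From mathcomp Require Import all_boot all_algebra.
From mathcomp Require Import boolp classical_sets.
From Stdlib Require Relation_Operators.

Set Implicit Arguments.
Unset Strict Implicit.
Unset Printing Implicit Defensive.

Import GRing.Theory.
Local Open Scope classical_set_scope.
Local Open Scope ring_scope.
Local Open Scope quotient_scope.

Section Subspaces.
Variables (k : fieldType) (A : algType k).
Implicit Types (E F : set A) (G : set (set A)).

Definition subspaces : set (set A) := [set E | GRing.submod_closed (mem E)].

Definition span (S : set A) : set A := smallest subspaces S.

(* The sum of the empty family is the zero subspace. *)
Definition subspace_sum G : set A := span (\bigcup_(E in G) E).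

Definition subspace_mul E F : set A :=
  span [set x | exists e f, [/\ E e, F f & x = e * f]].

Definition scalars : set A := [set x | exists c : k, x = c%:A].

End Subspaces.

Arguments subspaces {k} A.
Arguments scalars {k A}.

Section AtomisticSubsemirings.
Variables (k : fieldType) (A : algType k).
Implicit Types (R G : set (set A)) (E F X Y Z : set A).

Definition atoms R : set (set A) :=
  [set X | [/\ R X, X <> [set 0] &
             forall Y, R Y -> Y <> [set 0] -> Y `<=` X -> Y = X]].

Record atomistic_subsemiring R : Prop := AtomisticSubsemiring {
  sub_subspaces : R `<=` subspaces A;
  has_zero : R [set 0];
  has_scalars : R scalars;
  sum_closed : forall G, G `<=` R -> R (subspace_sum G);
  cap_closed : forall G, G `<=` R -> G !=set0 -> R (\bigcap_(E in G) E);
  mul_closed : forall E F, R E -> R F -> R (subspace_mul E F);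
  atomistic : forall E, R E -> E <> [set 0] ->
    exists2 G, G `<=` atoms R & E = subspace_sum G
}.

Definition entire R : Prop :=
  forall E F, R E -> R F -> subspace_mul E F = [set 0] ->
    E = [set 0] \/ F = [set 0].

Definition hyperprod R X Y : set (set A) :=
  [set Z | atoms R Z /\ Z `<=` subspace_mul X Y].

Definition weakly_reproducible R : Prop :=
  forall X, atoms R X -> exists Y Z,
    [/\ atoms R Y, atoms R Z & (hyperprod R X Y `&` hyperprod R Z X) scalars].

(* The product Z_1 Z_2 ... Z_n, n >= 1, with its first factor singled out. *)
Definition atom_prod R (Z1 : atoms R) (s : seq (atoms R)) : set A :=
  foldl (fun E (Z : atoms R) => subspace_mul E (\val Z)) (\val Z1) s.

Definition zeta R (X Y : atoms R) : Prop :=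
  exists (Z1 : atoms R) (s : seq (atoms R)),
    \val X `<=` atom_prod Z1 s /\ \val Y `<=` atom_prod Z1 s.

Definition zeta_star R : atoms R -> atoms R -> Prop :=
  Relation_Operators.clos_trans (atoms R) (@zeta R).

Definition zeta_starb R : rel (atoms R) :=
  fun X Y : atoms R => `[< zeta_star X Y >].

Lemma zeta_starb_refl R : reflexive (@zeta_starb R).
Proof.
move=> X; apply/asboolP; apply: Relation_Operators.t_step.
by exists X, [::]; split.
Qed.

Lemma zeta_starb_sym R : symmetric (@zeta_starb R).
Proof.
have sym (X Y : atoms R) : zeta_star X Y -> zeta_star Y X.
  elim=> {X Y} [X Y [Z1 [s [XZ YZ]]]|X Y Z _ YX _ ZY].
    by apply: Relation_Operators.t_step; exists Z1, s.
  exact: Relation_Operators.t_trans ZY YX.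
by move=> X Y; apply/asboolP/asboolP => /sym.
Qed.

Lemma zeta_starb_trans R : transitive (@zeta_starb R).
Proof.
move=> Y X Z /asboolP XY /asboolP YZ; apply/asboolP.
exact: Relation_Operators.t_trans XY YZ.
Qed.

Canonical zeta_star_equiv R : equiv_rel (atoms R) :=
  EquivRel (@zeta_starb R)
    (@zeta_starb_refl R) (@zeta_starb_sym R) (@zeta_starb_trans R).

Definition atom_quotient R := {eq_quot (@zeta_starb R)}.

Definition atom_class R (X : atoms R) : atom_quotient R :=
  \pi_({eq_quot (@zeta_starb R)}) X.

End AtomisticSubsemirings.

(* Main.v *)
Require Import Defs.
From HB Require Import structures.
From mathcomp Require Import all_boot all_algebra.
From mathcomp Require Import boolp classical_sets.
From Stdlib Require Relation_Operators.

(** Everything rests on the multiplication of subspaces being associative,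
    monotone, and having the scalars as a unit.  Associativity
    ([subspace_mulA]) makes the product of two products of atoms again a product
    of atoms ([atom_prod_cat]); with monotonicity, if X, X' lie in a product P
    of atoms, then XY and X'Y lie in the product PY.  Hence any atom below XY is
    zeta-related to any atom below X'Y, and walking along chains shows that the
    class of an atom below XY depends only on the classes of X and Y.

    Since R is entire and atomistic, XY contains an atom; [below X Y] is an
    arbitrary choice of one, and the product of classes is the class of this
    choice.  The monoid laws need no computation in the quotient: for
    associativity both bracketings give atoms below the same product XYZ, and
    the unit is the class of the scalars (an atom, being a line) because an atom
    below kX = X is below X.

    For the second part, weak reproducibility says that each class has a left
    and a right inverse, and in a monoid these coincide. *)

Set Implicit Arguments.
Unset Strict Implicit.
Unset Printing Implicit Defensive.

Import GRing.Theory.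
Local Open Scope classical_set_scope.
Local Open Scope ring_scope.
Local Open Scope quotient_scope.

(** * Products of subspaces *)

Section SubspaceProducts.
Variables (k : fieldType) (A : algType k).
Implicit Types (E F G S V : set A).

Lemma subspacesP V :
  subspaces A V <-> V 0 /\ forall c x y, V x -> V y -> V (c *: x + y).
Proof.
split=> [[V0 VD]|[V0 VD]]; split.
- by move: V0; rewrite inE.
- by move=> c x y Vx Vy; have := VD c x y; rewrite !inE; apply.
- by rewrite inE.
- by move=> c x y; rewrite !inE; exact: VD.
Qed.

Lemma span_subspace S : subspaces A (Defs.span S).
Proof.
apply/subspacesP; split=> [V [/subspacesP[]]//|c x y Sx Sy V VS].
by have [/subspacesP[_ VD] _] := VS; apply: VD; [exact: Sx|exact: Sy].
Qed.

Lemma subspace_preim_mulr V g :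
  subspaces A V -> subspaces A [set x | V (x * g)].
Proof.
move=> /subspacesP[V0 VD]; apply/subspacesP; split=> /=; first by rewrite mul0r.
by move=> c x y Vx Vy; rewrite mulrDl -scalerAl; exact: VD.
Qed.

Lemma subspace_preim_mull V e :
  subspaces A V -> subspaces A [set x | V (e * x)].
Proof.
move=> /subspacesP[V0 VD]; apply/subspacesP; split=> /=; first by rewrite mulr0.
by move=> c x y Vx Vy; rewrite mulrDr -scalerAr; exact: VD.
Qed.

Lemma mem_subspace_mul E F e f : E e -> F f -> subspace_mul E F (e * f).
Proof. by move=> Ee Ff; apply: sub_gen_smallest; exists e, f. Qed.

Lemma subspace_mul_sub E F V : subspaces A V ->
  (forall e f, E e -> F f -> V (e * f)) -> subspace_mul E F `<=` V.
Proof.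
by move=> subV EFV; apply: smallest_sub => // _ [e [f [Ee Ff ->]]]; exact: EFV.
Qed.

Lemma subspace_mulS E E' F F' : E `<=` E' -> F `<=` F' ->
  subspace_mul E F `<=` subspace_mul E' F'.
Proof.
move=> EE' FF'; apply: subspace_mul_sub; first exact: span_subspace.
by move=> e f /EE' E'e /FF' F'f; exact: mem_subspace_mul.
Qed.

(** Multiplication by a fixed element is linear, so that an inclusion for the
    elements of a span can be tested on the spanning products. *)
Lemma subspace_mulA E F G :
  subspace_mul (subspace_mul E F) G = subspace_mul E (subspace_mul F G).
Proof.
rewrite eqEsubset; split; apply: subspace_mul_sub; try exact: span_subspace.
  move=> x g EFx Gg; move: x EFx; apply: subspace_mul_sub.
    exact/subspace_preim_mulr/span_subspace.
  by move=> e f Ee Ff /=; rewrite -mulrA; do 2![apply: mem_subspace_mul => //].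
move=> e x Ee; move: x; apply: subspace_mul_sub.
  exact/subspace_preim_mull/span_subspace.
by move=> f g Ff Gg /=; rewrite mulrA; do 2![apply: mem_subspace_mul => //].
Qed.

Lemma subspace_mul1l E : subspaces A E -> subspace_mul scalars E = E.
Proof.
move=> subE; have /subspacesP[E0 ED] := subE.
rewrite eqEsubset; split=> [|x Ex].
  apply: subspace_mul_sub => // _ x [c ->] Ex.
  by rewrite mulr_algl -[_ *: _]addr0; exact: ED.
by rewrite -(mul1r x); apply: mem_subspace_mul => //; exists 1; rewrite scale1r.
Qed.

Lemma subspace_mul1r E : subspaces A E -> subspace_mul E scalars = E.
Proof.
move=> subE; have /subspacesP[E0 ED] := subE.
rewrite eqEsubset; split=> [|x Ex].
  apply: subspace_mul_sub => // x _ Ex [c ->].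
  by rewrite mulr_algr -[_ *: _]addr0; exact: ED.
by rewrite -(mulr1 x); apply: mem_subspace_mul => //; exists 1; rewrite scale1r.
Qed.

Lemma scalars_neq0 : (scalars : set A) <> [set 0].
Proof.
move=> /seteqP[k0 _]; have : (1 : A) = 0 by apply: k0; exists 1; rewrite scale1r.
by move/eqP; rewrite oner_eq0.
Qed.

Lemma scalars_sub_subspace V :
  subspaces A V -> V <> [set 0] -> V `<=` scalars -> scalars `<=` V.
Proof.
move=> /subspacesP[V0 VD] Vneq0 Vk _ [d ->].
have [x Vx x0] : exists2 x, V x & x <> 0.
  apply: contrapT => noV; apply: Vneq0; apply/seteqP; split=> [x Vx|_ ->//].
  by apply: contrapT => x0; apply: noV; exists x.
(* d 1 is obtained by rescaling a nonzero element c 1 of V *)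
have [c xE] := Vk _ Vx.
have c0 : c != 0 by apply/eqP => c0; apply: x0; rewrite xE c0 scale0r.
suff -> : d%:A = (d / c) *: x + 0 :> A by exact: VD.
by rewrite addr0 xE scalerA divfK.
Qed.

End SubspaceProducts.

(** * The multiplication of atoms up to [zeta_star] *)

Section AtomQuotient.
Variables (k : fieldType) (A : algType k) (R : set (set A)).
Hypotheses (atomisticR : atomistic_subsemiring R) (entireR : entire R).
Implicit Types (X Y Z : atoms R) (s t : seq (atoms R)).

Lemma atomP X : atoms R (\val X).
Proof. exact: set_valP. Qed.

Lemma atom_in X : R (\val X).
Proof. by have [] := atomP X. Qed.

Lemma atom_subspace X : subspaces A (\val X).
Proof. exact/(sub_subspaces atomisticR)/atom_in. Qed.

Lemma scalars_atom : atoms R scalars.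
Proof.
split; [exact: has_scalars|exact: scalars_neq0|move=> V RV V0 Vk].
rewrite eqEsubset; split=> //; apply: scalars_sub_subspace => //.
exact: (sub_subspaces atomisticR).
Qed.

Definition unit_atom : atoms R := SigSub (mem_set scalars_atom).

Lemma exists_atom_sub (E : set A) : R E -> E <> [set 0] ->
  exists X, \val X `<=` E.
Proof.
move=> RE E0; have [G GA EG] := atomistic atomisticR RE E0.
have [X GX] : G !=set0.
  (* the empty sum is the zero subspace *)
  apply/set0P/eqP => G0; apply: E0; rewrite EG G0 /subspace_sum bigcup_set0.
  rewrite eqEsubset; split=> [|_ ->].
    apply: smallest_sub => //; apply: (sub_subspaces atomisticR).
    exact: has_zero.
  by have /subspacesP[] := span_subspace (set0 : set A).
exists (SigSub (mem_set (GA _ GX))) => x /= Xx.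
by rewrite EG; apply: sub_gen_smallest; exists X.
Qed.

Lemma exists_below X Y :
  exists Z, \val Z `<=` subspace_mul (\val X) (\val Y).
Proof.
apply: exists_atom_sub; first by apply: mul_closed => //; exact: atom_in.
have [_ X0 _] := atomP X; have [_ Y0 _] := atomP Y.
by move=> /entireR[] //; exact: atom_in.
Qed.

(** Choosing one atom below each product turns the hyperproduct into maps on
    atoms, so that a chain for [zeta_star] in one factor is carried, link by
    link, to a chain between the chosen atoms. *)
Definition below X Y : atoms R := projT1 (cid (exists_below X Y)).

Lemma below_sub X Y : \val (below X Y) `<=` subspace_mul (\val X) (\val Y).
Proof. exact: projT2 (cid (exists_below X Y)). Qed.

Lemma atom_prod_cat X s Y t :
  subspace_mul (atom_prod X s) (atom_prod Y t) = atom_prod X (s ++ Y :: t).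
Proof.
elim/last_ind: t => [|t Z IHt]; first by rewrite /atom_prod foldl_cat.
by rewrite /atom_prod -rcons_cons -rcons_cat !foldl_rcons -subspace_mulA IHt.
Qed.

Lemma zeta_below_mull X X' Y : zeta X X' -> zeta (below X Y) (below X' Y).
Proof.
move=> [Z [s [XZ X'Z]]]; exists Z, (s ++ [:: Y]); rewrite -atom_prod_cat.
by split; apply: subset_trans (@below_sub _ _) _; exact: subspace_mulS.
Qed.

Lemma zeta_below_mulr X Y Y' : zeta Y Y' -> zeta (below X Y) (below X Y').
Proof.
move=> [Z [s [YZ Y'Z]]]; exists X, (Z :: s).
(* X is the product of the one-term family X *)
rewrite -[Z :: s]/([::] ++ Z :: s) -atom_prod_cat.
by split; apply: subset_trans (@below_sub _ _) _; exact: subspace_mulS.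
Qed.

Lemma zeta_star_homo (f : atoms R -> atoms R) :
  (forall X Y, zeta X Y -> zeta (f X) (f Y)) ->
  forall X Y, zeta_star X Y -> zeta_star (f X) (f Y).
Proof.
move=> f_zeta X Y; elim=> {X Y} [X Y /f_zeta XY|X Y Z _ XY _ YZ].
  exact: Relation_Operators.t_step.
exact: Relation_Operators.t_trans XY YZ.
Qed.

Lemma atom_classP X Y : atom_class X = atom_class Y <-> zeta_star X Y.
Proof.
split=> [/eqmodP/asboolP //|XY]; exact/eqmodP/asboolP.
Qed.

Lemma atom_class_zeta X Y : zeta X Y -> atom_class X = atom_class Y.
Proof. by move=> XY; apply/atom_classP; exact: Relation_Operators.t_step. Qed.

Lemma atom_class_below X X' Y Y' :
  atom_class X = atom_class X' -> atom_class Y = atom_class Y' ->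
  atom_class (below X Y) = atom_class (below X' Y').
Proof.
move=> /atom_classP XX' /atom_classP YY'; transitivity (atom_class (below X' Y)).
  apply/atom_classP; apply: (@zeta_star_homo (below^~ Y)) XX' => X1 X2.
  exact: zeta_below_mull.
by apply/atom_classP; apply: zeta_star_homo YY'; exact: zeta_below_mulr.
Qed.

Lemma atom_class_repr (a : atom_quotient R) : atom_class (repr a) = a.
Proof. exact: reprK. Qed.

Definition class_unit : atom_quotient R := atom_class unit_atom.

Definition class_mul (a b : atom_quotient R) : atom_quotient R :=
  atom_class (below (repr a) (repr b)).

Lemma class_mulE X Y :
  class_mul (atom_class X) (atom_class Y) = atom_class (below X Y).
Proof. by apply: atom_class_below; rewrite atom_class_repr. Qed.

(** The choice made by [below] is immaterial: any two atoms below XY are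
    related by the product XY itself. *)
Lemma class_mul_hyperprod X Y Z : hyperprod R (\val X) (\val Y) (\val Z) ->
  class_mul (atom_class X) (atom_class Y) = atom_class Z.
Proof.
move=> [_ ZXY]; rewrite class_mulE; apply: atom_class_zeta.
by exists X, [:: Y]; split=> //; exact: below_sub.
Qed.

Lemma class_mulA : associative class_mul.
Proof.
move=> a b c; rewrite -(atom_class_repr a) -(atom_class_repr b).
rewrite -(atom_class_repr c) !class_mulE; apply: atom_class_zeta.
exists (repr a), [:: repr b; repr c]; rewrite /atom_prod /=.
split; first rewrite subspace_mulA;
  apply: subset_trans (@below_sub _ _) _;
  by apply: subspace_mulS => //; exact: below_sub.
Qed.

Lemma class_mul1l : left_id class_unit class_mul.
Proof.
move=> a; rewrite -(atom_class_repr a); apply: class_mul_hyperprod.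
split; first exact: atomP.
by rewrite /= subspace_mul1l //; exact: atom_subspace.
Qed.

Lemma class_mul1r : right_id class_unit class_mul.
Proof.
move=> a; rewrite -(atom_class_repr a); apply: class_mul_hyperprod.
split; first exact: atomP.
by rewrite /= subspace_mul1r //; exact: atom_subspace.
Qed.

Lemma class_mul_invertible : weakly_reproducible R ->
  forall a, exists b, class_mul b a = class_unit /\ class_mul a b = class_unit.
Proof.
move=> wR a; rewrite -(atom_class_repr a); set X := repr a.
have [Y [Z [aY aZ [XY ZX]]]] := wR _ (atomP X).
pose y := atom_class (SigSub (mem_set aY)).
pose z := atom_class (SigSub (mem_set aZ)).
have xy : class_mul (atom_class X) y = class_unit by exact: class_mul_hyperprod.
have zx : class_mul z (atom_class X) = class_unit by exact: class_mul_hyperprod.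
exists y; split=> //.
by rewrite -[y]class_mul1l -zx -(class_mulA z) xy class_mul1r.
Qed.

End AtomQuotient.

Theorem theorem3p5 (k : fieldType) (A : algType k) (R : set (set A))
    (atomisticR : atomistic_subsemiring R) (entireR : entire R) :
  (forall X Y : atoms R, hyperprod R (\val X) (\val Y) !=set0) /\
  exists (e : atom_quotient R) (mul : Monoid.law e),
    (forall X Y Z : atoms R, hyperprod R (\val X) (\val Y) (\val Z) ->
       mul (atom_class X) (atom_class Y) = atom_class Z) /\
    (weakly_reproducible R ->
       exists inv : atom_quotient R -> atom_quotient R,
         left_inverse e inv mul /\ right_inverse e inv mul).
Proof.
split=> [X Y|].
  exists (\val (below atomisticR entireR X Y)).
  by split; [exact: atomP|exact: below_sub].
pose mul_isLaw := Monoid.isLaw.Build _ _ _ (class_mulA atomisticR entireR)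
  (class_mul1l atomisticR entireR) (class_mul1r atomisticR entireR).
pose mul : Monoid.law (class_unit atomisticR) :=
  HB.pack (class_mul atomisticR entireR) mul_isLaw.
exists (class_unit atomisticR), mul; split.
  by move=> X Y Z; exact: class_mul_hyperprod.
move=> /(class_mul_invertible atomisticR entireR)/choice[inv invP].
by exists inv; split=> a; have [] := invP a.
Qed.
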